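(* Let $(V,\omega,\mu)$ be a connected locally finite weighted graph, let $\Omega\subset V$ be a nonempty finite subset, let $1<p<\infty$, and let $w:\Omega\to[0,\infty)$ with $w\not\equiv0$. Then $$\lambda_{1,p}(\Omega,w)\ge\frac{1}{\mathcal{R}_p(\Omega)\,\|w\|_{\ell^1(\Omega,\mu)}}.$$ Moreover, for every $1<s<\infty$, $$\lambda_{1,p}(\Omega,w)\ge\frac{1}{\mathcal{R}_{p,s}(\Omega)\,\|w\|_{\ell^s(\Omega,\mu)}}.$$
   Context: A weighted graph is a triple $(V,\omega,\mu)$ where $V$ is a countably infinite set, $\mu:V\to(0,\infty)$, and $\omega:V\times V\to[0,\infty)$ satisfies $\omega_{xy}=\omega_{yx}$ and $\omega_{xx}=0$. Write $x\sim y$ if $\omega_{xy}>0$. The graph is locally finite if every vertex has finitely many neighbours, and connected if any two vertices are joined by a finite path $x=x_0\sim x_1\sim\cdots\sim x_m=y$. For a nonempty finite $\Omega\subset V$: $X_V(\Omega)=\{u:V\to\mathbb{R}:u=0\text{ in }V\setminus\Omega\}$; $E_p(u)=\frac12\sum_{x,y\in V}\omega_{xy}|u(y)-u(x)|^p$; for $1\le r<\infty$, $\|f\|_{\ell^r(\Omega,\mu)}=(\sum_{x\in\Omega}\mu(x)|f(x)|^r)^{1/r}$; for $x\in\Omega$, $\operatorname{Cap}_p(x,\Omega)=\inf\{E_p(\varphi):\varphi\in X_V(\Omega),\varphi(x)=1\}\in(0,\infty)$. The capacitary radii are $$\mathcal{R}_p(\Omega)=\max_{x\in\Omega}\operatorname{Cap}_p(x,\Omega)^{-1},\qquad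 \mathcal{R}_{p,s}(\Omega)=\max_{u\in X_V(\Omega),\,u\not\equiv0}\frac{\|u\|_{\ell^{ps'}(\Omega,\mu)}^p}{E_p(u)}\quad(1<s<\infty),$$ where $s'=s/(s-1)$. The first weighted Dirichlet eigenvalue is $$\lambda_{1,p}(\Omega,w)=\inf\left\{\frac{E_p(u)}{\sum_{x\in\Omega}\mu(x)w(x)|u(x)|^p}:\ u\in X_V(\Omega),\ \sum_{x\in\Omega}\mu(x)w(x)|u(x)|^p>0\right\}.$$ *)

(* Defs.v *)
From HB Require Import structures.
From mathcomp Require Import all_boot all_order all_algebra finmap.
From mathcomp Require Import all_classical all_reals all_analysis.
Import Order.TTheory GRing.Theory Num.Theory.

Set Implicit Arguments.
Unset Strict Implicit.
Unset Printing Implicit Defensive.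

Local Open Scope classical_set_scope.
Local Open Scope ring_scope.

Record weighted_graph (R : realType) (V : choiceType) := WeightedGraph {
  omega : V -> V -> R;
  mu : V -> R;
  vertices_countable : countable [set: V];
  vertices_infinite : infinite_set [set: V];
  mu_gt0 : forall x, 0 < mu x;
  omega_ge0 : forall x y, 0 <= omega x y;
  omega_sym : forall x y, omega x y = omega y x;
  omega_diag : forall x, omega x x = 0 }.

Definition adj (R : realType) (V : choiceType) (G : weighted_graph R V) :
  rel V := fun x y => 0 < omega G x y.

Definition locally_finite (R : realType) (V : choiceType)
    (G : weighted_graph R V) : Prop :=
  forall x, finite_set [set y | adj G x y].

Definition connected_graph (R : realType) (V : choiceType)
    (G : weighted_graph R V) : Prop :=
  forall x y, exists s : seq V, path (adj G) x s /\ last x s = y.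

Definition XV (R : realType) (V : choiceType) (Omega : {fset V}) :
  set (V -> R) := [set u | forall x, x \notin Omega -> u x = 0].

(* An extended real for arbitrary [u]; for a locally finite graph it is finite
   when [u] is finitely supported. *)
Definition energy (R : realType) (V : choiceType) (G : weighted_graph R V)
    (p : R) (u : V -> R) : \bar R :=
  ((2^-1)%:E *
   \esum_(z in [set: V * V])
     (omega G z.1 z.2 * `|u z.2 - u z.1| `^ p)%:E)%E.

Definition lnorm (R : realType) (V : choiceType) (G : weighted_graph R V)
    (Omega : {fset V}) (r : R) (f : Omega -> R) : R :=
  (\sum_(x : Omega) mu G (val x) * `|f x| `^ r) `^ r^-1.

Definition capacity (R : realType) (V : choiceType) (G : weighted_graph R V)
    (Omega : {fset V}) (p : R) (x : V) : \bar R :=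
  ereal_inf [set energy G p phi | phi in [set phi | XV Omega phi /\ phi x = 1]].

(* [-oo] is the neutral element of [maxe], so this is the plain maximum when
   [Omega] is nonempty. *)
Definition cap_radius (R : realType) (V : choiceType) (G : weighted_graph R V)
    (Omega : {fset V}) (p : R) : \bar R :=
  \big[maxe/-oo%E]_(x : Omega) (capacity G Omega p (val x))^-1%E.

Definition conj_exp (R : realType) (s : R) : R := s / (s - 1).

(* The maximum over the nonzero functions of [XV Omega], written as a supremum:
   the quotient is continuous and homogeneous of degree 0 on a
   finite-dimensional space, so the supremum is attained. *)
Definition cap_radius_s (R : realType) (V : choiceType)
    (G : weighted_graph R V) (Omega : {fset V}) (p s : R) : \bar R :=
  ereal_sup
    [set ((lnorm G (p * conj_exp s) (fun x : Omega => u (val x)) `^ p)%:E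
          / energy G p u)%E
    | u in [set u | XV Omega u /\ exists x, u x != 0]].

Definition weighted_mass (R : realType) (V : choiceType)
    (G : weighted_graph R V) (Omega : {fset V}) (p : R) (w : Omega -> R)
    (u : V -> R) : R :=
  \sum_(x : Omega) mu G (val x) * w x * `|u (val x)| `^ p.

Definition lambda1 (R : realType) (V : choiceType) (G : weighted_graph R V)
    (Omega : {fset V}) (p : R) (w : Omega -> R) : \bar R :=
  ereal_inf
    [set (energy G p u / (weighted_mass G p w u)%:E)%E
    | u in [set u | XV Omega u /\ 0 < weighted_mass G p w u]].

(* Main.v *)
Require Import Defs.
From HB Require Import structures.
From mathcomp Require Import all_boot all_order all_algebra finmap.
From mathcomp Require Import all_classical all_reals all_analysis.
Import Order.TTheory GRing.Theory Num.Theory.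

(** Fix a test function [u] vanishing off [Omega].  Both bounds come from the
    same two-step estimate of the weighted mass of [u] by its energy.

    - Splitting: the mass is at most [N * W], where [W] is the norm of the
      weight and [N] measures the size of [u].  For the first bound
      [N = max |u|^p] and [W] is the l^1 norm; for the second one, Hölder's
      inequality gives the l^s norm for [W] and the p-th power of the l^(ps')
      norm of [u] for [N] ([hoelder_sum], [weighted_mass_hoelder]).
    - Capacitary estimate: [N] is at most the capacitary radius times the
      energy.  For the second radius this is its definition.  For the first
      one, rescale [u] to take the value 1 at a point [x] where [|u|] is
      maximal: the rescaled function is a competitor for the capacity of [x],
      and the energy is homogeneous of degree [p] ([capacity_inv_ge]).

    Hence mass is at most radius times [W] times energy, and the infimum over
    [u] gives the claim ([lambda1_ge]).  Everything takes place in the extended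
    reals, where [0^-1 = +oo] and [+oo^-1 = 0].  These conventions absorb the
    degenerate cases: a test function of infinite energy has Rayleigh quotient
    [+oo], and a vanishing energy or capacity makes the radius [+oo], so that
    the claimed lower bound is [0]. *)

Set Implicit Arguments.
Unset Strict Implicit.
Unset Printing Implicit Defensive.

Local Open Scope classical_set_scope.
Local Open Scope ring_scope.

(** Hölder's inequality for two terms ([hoelder2]) propagates to finite sums by
    induction.  The measure [m i] is split as [m i `^ p^-1 * m i `^ q^-1], each
    factor being absorbed by one of the two functions. *)
Lemma hoelder_sum (R : realType) (I : finType) (m f g : I -> R) (p q : R) :
  (forall i, 0 <= m i) -> (forall i, 0 <= f i) -> (forall i, 0 <= g i) ->
  0 < p -> 0 < q -> p^-1 + q^-1 = 1 ->
  \sum_i m i * (f i * g i) <=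
    (\sum_i m i * f i `^ p) `^ p^-1 * (\sum_i m i * g i `^ q) `^ q^-1.
Proof.
move=> m0 f0 g0 p0 q0 pq.
pose K (x y z : R) := [/\ x <= y `^ p^-1 * z `^ q^-1, 0 <= y & 0 <= z].
suff [] : K (\sum_i m i * (f i * g i)) (\sum_i m i * f i `^ p)
            (\sum_i m i * g i `^ q) by [].
apply: (big_rec3 K) => [|i x y z _ [xyz y0 z0]].
  by split => //; rewrite mulr_ge0 ?powR_ge0.
have rootVK (a r : R) : 0 <= a -> 0 < r -> (a `^ r^-1) `^ r = a.
  by move=> a0 r0; rewrite -powRrM mulVf ?gt_eqF// powRr1.
split; [|by rewrite addr_ge0 ?mulr_ge0 ?powR_ge0..].
have -> : m i * (f i * g i) = (m i `^ p^-1 * f i) * (m i `^ q^-1 * g i).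
  rewrite mulrACA -powRD ?pq ?powRr1//.
  by rewrite oner_eq0.
have := @hoelder2 R (m i `^ p^-1 * f i) (y `^ p^-1)
  (m i `^ q^-1 * g i) (z `^ q^-1) p q.
rewrite !powRM ?powR_ge0// !rootVK// => h.
apply: le_trans (h _ _ _ _ _ _ _) => //; rewrite ?mulr_ge0 ?powR_ge0//.
by rewrite lerD2l.
Qed.

Section Graph.
Context {R : realType} {V : choiceType} (G : weighted_graph R V).
Implicit Types (Omega : {fset V}) (u : V -> R) (p : R).

Lemma energy_ge0 p u : (0 <= energy G p u)%E.
Proof.
rewrite mule_ge0 ?lee_fin//; apply: esum_ge0 => z _.
by rewrite lee_fin mulr_ge0 ?powR_ge0// omega_ge0.
Qed.

Lemma energyZ_le p (t : R) u :
  (energy G p (fun x => t * u x)%R <= (`|t| `^ p)%:E * energy G p u)%E.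
Proof.
rewrite /energy muleCA lee_pmul2l// ?lte_fin//.
apply: ge_ereal_sup => _ [A AF <-].
under eq_fsbigr do rewrite -mulrBr normrM powRM// mulrCA EFinM.
rewrite -ge0_mule_fsumr => [|z]; last first.
  by rewrite lee_fin mulr_ge0 ?powR_ge0// omega_ge0.
by apply: lee_wpmul2l; rewrite ?lee_fin ?powR_ge0//; apply: ereal_sup_ubound;
  exists A.
Qed.

Lemma capacity_ge0 Omega p x : (0 <= capacity G Omega p x)%E.
Proof. by apply: le_ereal_inf_tmp => _ [u _ <-]; exact: energy_ge0. Qed.

(** [u] divided by [u x] is a competitor for the capacity of [x]. *)
Lemma capacity_inv_ge Omega p u x : XV Omega u -> u x != 0 ->
  ((`|u x| `^ p)%:E / energy G p u <= (capacity G Omega p x)^-1)%E.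
Proof.
move=> uO ux.
have N0 : 0 < `|u x| `^ p by rewrite powR_gt0// normr_gt0.
have TN : `|(u x)^-1| `^ p = (`|u x| `^ p)^-1.
  apply/esym/mulr1_eq.
  by rewrite -powRM// -normrM mulfV// normr1 powR1.
have -> : ((`|u x| `^ p)%:E / energy G p u =
    ((`|(u x)^-1| `^ p)%:E * energy G p u)^-1)%E.
  rewrite TN.
  have /inveM -> : inveM_def ((`|u x| `^ p)^-1)%:E (energy G p u).
    rewrite inveM_defE eqe invr_eq0 gt_eqF//= !lte_fin invr_gt0 N0 implybT andbT.
    by rewrite lee_fin invr_ge0 ltW//= ltry implybT.
  by rewrite inver invr_eq0 gt_eqF// invrK.
rewrite lee_pV2 ?inE ?capacity_ge0//; last first.
  by rewrite mule_ge0 ?energy_ge0// lee_fin powR_ge0.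
apply: le_trans (energyZ_le _ _ _); apply: ereal_inf_lbound.
exists (fun y => (u x)^-1 * u y) => //; split; last by rewrite mulVf.
by move=> y yO; rewrite (uO y)// mulr0.
Qed.

(** Reduction of both bounds to a splitting of the weighted mass.  The
    capacitary estimate is stated with a quotient so that the degenerate
    energies are covered: the quotient is [+oo] at energy [0], and the
    conclusion is trivial at energy [+oo]. *)
Lemma lambda1_ge Omega p (w : Omega -> R) (rho : \bar R) (W : R) :
  (forall u, XV Omega u -> 0 < weighted_mass G p w u -> exists N : R,
    [/\ 0 <= N, weighted_mass G p w u <= N * W
       & (N%:E / energy G p u <= rho)%E]) ->
  ((rho * W%:E)^-1 <= lambda1 G p w)%E.
Proof.
move=> split_mass; apply: le_ereal_inf_tmp => _ [u [uO m0] <-].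
have [N [N0 mNW Ne]] := split_mass u uO m0.
move: (weighted_mass G p w u) m0 mNW => m m0 mNW.
have := energy_ge0 p u; move: (energy G p u) Ne => e Ne e0.
have NW0 : 0 < N * W by exact: lt_le_trans mNW.
have {}N0 : 0 < N.
  by rewrite lt_neqAle N0 andbT; apply: contraTneq NW0 => <-; rewrite mul0r ltxx.
have W0 : 0 < W by rewrite pmulr_rgt0 in NW0.
rewrite (inver m) gt_eqF//.
case: e e0 Ne => [e| |]//; last by rewrite gt0_mulye ?leey// lte_fin invr_gt0.
rewrite lee_fin => e0; have := e0.
rewrite [0 <= e]le_eqVlt => /predU1P[<-|{}e0].
  rewrite inve0 gt0_muley// leye_eq => /eqP ->.
  by rewrite gt0_mulye// invey mul0e.
rewrite inver gt_eqF//; case: rho {split_mass} => [r| |].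
- rewrite !lee_fin ler_pdivrMr// => Nre.
  have re0 : 0 < r * e by exact: lt_le_trans Nre.
  have r0 : 0 < r by rewrite pmulr_lgt0 in re0.
  rewrite inver gt_eqF ?mulr_gt0// lee_fin.
  rewrite ler_pdivlMr// ler_pdivrMl ?mulr_gt0//.
  by rewrite (le_trans mNW)// mulrAC ler_wpM2r// ltW.
- by rewrite gt0_mulye// invey lee_fin divr_ge0// ltW.
- by rewrite leeNy_eq.
Qed.

Lemma lnorm1E Omega (w : Omega -> R) : (forall x, 0 <= w x) ->
  lnorm G 1 w = \sum_(x : Omega) mu G (val x) * w x.
Proof.
move=> w0; rewrite /lnorm invr1.
under eq_bigr do rewrite powRr1// ger0_norm//.
by rewrite powRr1// sumr_ge0// => x _; rewrite mulr_ge0// ltW// mu_gt0.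
Qed.

Lemma weighted_mass_sup Omega p (w : Omega -> R) u (N : R) :
  (forall x, 0 <= w x) -> (forall x : Omega, `|u (val x)| `^ p <= N) ->
  weighted_mass G p w u <= N * lnorm G 1 w.
Proof.
move=> w0 uN; rewrite lnorm1E// mulr_sumr; apply: ler_sum => x _.
by rewrite [leRHS]mulrC ler_wpM2l// mulr_ge0// ltW// mu_gt0.
Qed.

Lemma conj_exp_gt0 (s : R) : 1 < s -> 0 < conj_exp s.
Proof. by move=> s1; rewrite divr_gt0 ?subr_gt0// (lt_trans ltr01). Qed.

Lemma conj_expE (s : R) : 1 < s -> s^-1 + (conj_exp s)^-1 = 1.
Proof.
move=> s1; have s0 : s != 0 by rewrite gt_eqF// (lt_trans ltr01).
by rewrite /conj_exp invf_div mulrBl mulfV// mul1r addrC subrK.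
Qed.

Lemma weighted_mass_hoelder Omega p (w : Omega -> R) u (s : R) :
  p != 0 -> (forall x, 0 <= w x) -> 1 < s ->
  weighted_mass G p w u <=
    lnorm G (p * conj_exp s) (fun x : Omega => u (val x)) `^ p * lnorm G s w.
Proof.
move=> p0 w0 s1.
rewrite /lnorm -powRrM invfM mulrAC mulVf// mul1r mulrC.
under [X in _ <= _ * X `^ _]eq_bigr do rewrite powRrM.
under [X in _ <= X `^ _ * _]eq_bigr do rewrite ger0_norm//.
rewrite /weighted_mass; under [X in X <= _]eq_bigr do rewrite -mulrA.
apply: hoelder_sum => //.
- by move=> x; rewrite ltW// mu_gt0.
- exact: lt_trans ltr01 s1.
- exact: conj_exp_gt0.
- exact: conj_expE.
Qed.

Lemma weighted_mass_neq0 Omega p (w : Omega -> R) u : p != 0 ->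
  0 < weighted_mass G p w u -> exists x : Omega, u (val x) != 0.
Proof.
move=> p0; apply: contraPP => /forallNP u0.
rewrite /weighted_mass big1 ?ltxx// => x _.
by have /negP/negPn/eqP -> := u0 x; rewrite normr0 powR0// mulr0.
Qed.

End Graph.

Theorem corollary4p1 (R : realType) (V : choiceType) (G : weighted_graph R V)
    (Gconn : connected_graph G) (Glf : locally_finite G)
    (Omega : {fset V}) (Omega0 : Omega != fset0)
    (p : R) (p1 : 1 < p)
    (w : Omega -> R) (w_ge0 : forall x, 0 <= w x) (w_neq0 : exists x, w x != 0) :
  ((cap_radius G Omega p * (lnorm G 1 w)%:E)^-1 <= lambda1 G p w)%E /\
  (forall s : R, 1 < s ->
    ((cap_radius_s G Omega p s * (lnorm G s w)%:E)^-1 <= lambda1 G p w)%E).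
Proof.
have p0 : 0 < p by exact: lt_trans ltr01 p1.
have pn0 : p != 0 by rewrite gt_eqF.
split=> [|s s1]; apply: lambda1_ge => u uO mass0;
  have [x0 ux0] := weighted_mass_neq0 pn0 mass0.
- case: (@arg_maxP _ _ _ x0 xpredT (fun x : Omega => `|u (val x)|)) => // x _ xmax.
  have ux : u (val x) != 0.
    by rewrite -normr_gt0 (lt_le_trans _ (xmax x0 isT))// normr_gt0.
  exists (`|u (val x)| `^ p); split; first exact: powR_ge0.
    apply: weighted_mass_sup => // y; apply: ge0_ler_powR; rewrite ?nnegrE//.
      exact: ltW.
    exact: xmax.
  apply: le_trans (capacity_inv_ge G p uO ux) _.
  exact: (le_bigmax -oo%E (fun x : Omega => (capacity G Omega p (val x))^-1%E)).
- exists (lnorm G (p * conj_exp s) (fun x : Omega => u (val x)) `^ p).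
  split; [exact: powR_ge0|exact: weighted_mass_hoelder|].
  apply: ereal_sup_ubound; exists u => //; split => //.
  by exists (val x0).
Qed.
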